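(* Let $\mathbf{X}$, $\mathbf{A}$ be $\sigma$-structures and $k\ge1$. The following are equivalent: (1) $\mathrm{SA}^k(\mathbf{X},\mathbf{A})$ is feasible; (2) there exists a sequence of $\sigma^*_k$-structures $\mathbf{Y}_0,\dots,\mathbf{Y}_n$ with $\mathbf{Y}_0=\mathbf{X}^{*k}$, $\mathbf{Y}_n=\mathbf{A}^{*k}$ such that for all $i=0,\dots,n-1$, $\mathbf{Y}_i\to\mathbf{Y}_{i+1}$ or $\mathbf{Y}_i\equiv_1\mathbf{Y}_{i+1}$; (3) there exist $\sigma^*_k$-structures $\mathbf{Y}_1,\mathbf{Y}_2$ with $\mathbf{X}^{*k}\to\mathbf{Y}_1$, $\mathbf{Y}_1\equiv_1\mathbf{Y}_2$ and $\mathbf{Y}_2\to\mathbf{A}^{*k}$.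
   Context: A signature $\sigma$ is a finite set of relation symbols with arities $\operatorname{ar}(R)\ge1$; a $\sigma$-structure has finite universe and relations $R^\mathbf{A}\subseteq A^{\operatorname{ar}(R)}$. $\mathbf{Y}\to\mathbf{Z}$ means there is a homomorphism (a map preserving all relations componentwise). Constraints: $\mathcal{C}_\mathbf{A}=\{R(\mathbf{a}):R\in\sigma,\mathbf{a}\in R^\mathbf{A}\}$ (formal symbols). For a tuple $\mathbf{a}$, $a_i$ is its $i$-th entry, $\{\mathbf{a}\}$ its set of entries; $\pi_\mathbf{i}\mathbf{a}=(a_{i_1},\dots,a_{i_n})$ for $\mathbf{i}=(i_1,\dots,i_n)$. $\equiv_1$: the factor graph of a structure $\mathbf{A}$ is the bipartite graph on $A\cup\mathcal{C}_\mathbf{A}$ with edges $\{a,R(\mathbf{a})\}$ for $a\in\{\mathbf{a}\}$, labelled $(\{i:a_i=a\},R)$; $\delta_0^\mathbf{A}(v)$ is one of two fixed symbols according as $v\in A$ or $v\in\mathcal{C}_\mathbf{A}$; $\delta_j^\mathbf{A}(v)=\{\{(\text{label of }\{v,w\},\delta^\mathbf{A}_{j-1}(w)):w\text{ adjacent to }v\}\}$; $\delta^\mathbf{A}(v)=(\delta_j^\mathbf{A}(v))_{j\ge0}$; $\mathbf{A}\equiv_1\mathbf{B}$ iff the multisets $\{\{\delta^\mathbf{A}(v)\}\}$, $\{\{\delta^\mathbf{B}(v)\}\}$ over all factor-graph vertices coincide. $\mathrm{SA}^k(\mathbf{X},\mathbf{A})$: variables $p_V(f)\in[0,1]$ for $V\subseteq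 X$, $1\le|V|\le k$, $f:V\to A$, and $p_{R(\mathbf{x})}(f)\in[0,1]$ for $R(\mathbf{x})\in\mathcal{C}_\mathbf{X}$, $f:\{\mathbf{x}\}\to A$; constraints $\sum_f p_V(f)=1$; $p_U(f)=\sum_{g:V\to A,g|_U=f}p_V(g)$ ($\emptyset\ne U\subseteq V$, $|V|\le k$); $p_U(f)=\sum_{g:\{\mathbf{x}\}\to A,g|_U=f}p_{R(\mathbf{x})}(g)$ ($\emptyset\ne U\subseteq\{\mathbf{x}\}$, $|U|\le k$); $p_{R(\mathbf{x})}(f)=0$ if $f(\mathbf{x})\notin R^\mathbf{A}$. Feasible means a rational solution exists. $\mathbf{A}^{*k}$: universe $\bigcup_{1\le j\le k}A^j\cup\mathcal{C}_\mathbf{A}$ (disjoint), signature $\sigma^*_k$, relations: unary $T_{j,S}=\{\mathbf{a}\in A^j:a_i=a_{i'}\ \forall i,i'\in S\}$ ($j\le k$, $S\subseteq[j]$); binary $T_{j,\mathbf{i}}=\{(\mathbf{a},\pi_\mathbf{i}\mathbf{a}):\mathbf{a}\in A^j\}$ ($j,j'\le k$, $\mathbf{i}\in[j]^{j'}$); unary $R_S=\{R(\mathbf{a}):\mathbf{a}\in R^\mathbf{A},a_i=a_{i'}\ \forall i,i'\in S\}$ ($R\in\sigma$, $S\subseteq[\operatorname{ar}(R)]$); binary $R_\mathbf{i}=\{(R(\mathbf{a}),\pi_\mathbf{i}\mathbf{a}):\mathbf{a}\in R^\mathbf{A}\}$ ($R\in\sigma$, $j\le k$, $\mathbf{i}\in[\operatorname{ar}(R)]^j$).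 *)

(* Defs.v *)
From HB Require Import structures.
From mathcomp Require Import all_boot all_order all_algebra.
From mathcomp Require Import finmap multiset.
Set Implicit Arguments. Unset Strict Implicit. Unset Printing Implicit Defensive.
Import Order.TTheory GRing.Theory Num.Theory.

Record sig := Sig { sym : finType; ar : sym -> nat }.

Record structure (s : sig) := Struct {
  univ : finType;
  srel : forall R : sym s, {set (ar R).-tuple univ} }.
Arguments Struct {s}.

Definition homto (s : sig) (Y Z : structure s) : Prop :=
  exists f : univ Y -> univ Z,
    forall (R : sym s) (t : (ar R).-tuple (univ Y)),
      t \in srel Y R -> map_tuple f t \in srel Z R.

Definition constr (s : sig) (Y : structure s) : finType :=
  {c : {R : sym s & (ar R).-tuple (univ Y)} | tagged c \in srel Y (tag c)}.

Definition scope (s : sig) (Y : structure s) (c : constr Y) : {set univ Y} :=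
  [set y | y \in (tagged (val c) : seq _)].

(** Vertices of the factor graph: universe elements and constraints. *)
Definition fvert (s : sig) (Y : structure s) : finType := (univ Y + constr Y)%type.

Definition label (s : sig) : finType := {R : sym s & {set 'I_(ar R)}}.

Definition mk_label (s : sig) (Y : structure s) (x : univ Y) (c : constr Y)
  : label s :=
  Tagged (fun R => {set 'I_(ar R)}) [set i | tnth (tagged (val c)) i == x].

Definition edge_label (s : sig) (Y : structure s) (v w : fvert Y)
  : option (label s) :=
  match v, w with
  | inl x, inr c => if x \in scope c then Some (mk_label x c) else None
  | inr c, inl x => if x \in scope c then Some (mk_label x c) else None
  | _, _ => None
  end.

Fixpoint color (s : sig) (j : nat) : choiceType :=
  match j with
  | 0 => bool
  | j'.+1 => multiset (label s * color s j')%type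
  end.

Fixpoint delta (s : sig) (Y : structure s) (j : nat) (v : fvert Y)
  : color s j :=
  match j as j0 return color s j0 with
  | 0 => (if v is inl _ then true else false)
  | j'.+1 =>
      seq_mset (pmap (fun w => omap (fun l => (l, @delta s Y j' w)) (edge_label v w))
                     (enum (fvert Y)))
  end.

(** Y ==_1 Z: the multisets of the colour sequences delta(v) = (delta_j(v))_j
    over all factor-graph vertices coincide, i.e. there is a bijection between
    the vertex sets preserving the whole colour sequence. *)
Definition equiv1 (s : sig) (Y Z : structure s) : Prop :=
  exists phi : fvert Y -> fvert Z,
    bijective phi /\ forall (v : fvert Y) (j : nat), @delta s Y j v = @delta s Z j (phi v).

(** A partial map f : V -> A is encoded as a finite function X -> option A
    whose domain is [pdom f]. *)
Definition pdom (X A : finType) (f : {ffun X -> option A}) : {set X} :=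
  [set x | f x != None].

Definition prestr (X A : finType) (U : {set X}) (g : {ffun X -> option A})
  : {ffun X -> option A} := [ffun x => if x \in U then g x else None].

Definition sat_constr (s : sig) (X A : structure s) (c : constr X)
  (f : {ffun univ X -> option (univ A)}) : bool :=
  [exists a in srel A (tag (val c)),
     map_tuple f (tagged (val c)) == map_tuple Some a].

Local Open Scope ring_scope.

Definition SA_feasible (s : sig) (X A : structure s) (k : nat) : Prop :=
  exists (pV : {set univ X} -> {ffun univ X -> option (univ A)} -> rat)
         (pC : constr X -> {ffun univ X -> option (univ A)} -> rat),
    (forall (V : {set univ X}) (f : {ffun univ X -> option (univ A)}),
       (1 <= #|V| <= k)%N -> pdom f = V -> 0 <= pV V f <= 1) /\
    (forall (c : constr X) (f : {ffun univ X -> option (univ A)}),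
       pdom f = scope c -> 0 <= pC c f <= 1) /\
    (forall V : {set univ X}, (1 <= #|V| <= k)%N ->
       \sum_(f : {ffun univ X -> option (univ A)} | pdom f == V) pV V f = 1) /\
    (forall (U V : {set univ X}) (f : {ffun univ X -> option (univ A)}), U != set0 -> U \subset V -> (#|V| <= k)%N ->
       pdom f = U ->
       pV U f = \sum_(g : {ffun univ X -> option (univ A)} | (pdom g == V) && (prestr U g == f)) pV V g) /\
    (forall (c : constr X) (U : {set univ X}) (f : {ffun univ X -> option (univ A)}), U != set0 -> U \subset scope c ->
       (#|U| <= k)%N -> pdom f = U ->
       pV U f = \sum_(g : {ffun univ X -> option (univ A)} | (pdom g == scope c) && (prestr U g == f)) pC c g) /\
    (forall (c : constr X) (f : {ffun univ X -> option (univ A)}),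
       pdom f = scope c -> ~~ @sat_constr s X A c f -> pC c f = 0).

Local Close Scope ring_scope.

(** Index j : 'I_k stands for the length j.+1 \in {1,...,k}. *)
Definition usym (s : sig) (k : nat) : finType :=
  ({j : 'I_k & {set 'I_j.+1}} + {R : sym s & {set 'I_(ar R)}})%type.
Definition bsym (s : sig) (k : nat) : finType :=
  ({j : 'I_k & {j' : 'I_k & (j'.+1).-tuple 'I_j.+1}}
   + {R : sym s & {j : 'I_k & (j.+1).-tuple 'I_(ar R)}})%type.

Definition sigstar (s : sig) (k : nat) : sig :=
  @Sig (usym s k + bsym s k)%type
       (fun r => match r with inl _ => 1 | inr _ => 2 end)%N.

Section Star.
Variables (s : sig) (k : nat) (A : structure s).

Definition tupsT : finType := {j : 'I_k & (j.+1).-tuple (univ A)}.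

Definition star_univ : finType := (tupsT + constr A)%type.

Definition isC (u : star_univ) (x : {R : sym s & (ar R).-tuple (univ A)}) : bool :=
  if u is inr c then val c == x else false.

Definition allEq (n : nat) (T : eqType) (a : n.-tuple T) (S : {set 'I_n}) : bool :=
  [forall i in S, [forall i' in S, tnth a i == tnth a i']].

Definition proj (n m : nat) (T : Type) (i : m.-tuple 'I_n) (a : n.-tuple T)
  : m.-tuple T := [tuple tnth a (tnth i l) | l < m].

Definition unary_holds (r : usym s k) (u : star_univ) : bool :=
  match r with
  | inl (existT j SS) =>
      [exists a : (j.+1).-tuple (univ A),
         (u == inl (Tagged (fun j0 : 'I_k => (j0.+1).-tuple (univ A)) a))
         && allEq a SS]
  | inr (existT R SS) =>
      [exists a : (ar R).-tuple (univ A),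
         [&& a \in srel A R,
             isC u (Tagged (fun R0 => (ar R0).-tuple (univ A)) a) & allEq a SS]]
  end.

Definition binary_holds (r : bsym s k) (u v : star_univ) : bool :=
  match r with
  | inl (existT j (existT j' i)) =>
      [exists a : (j.+1).-tuple (univ A),
         (u == inl (Tagged (fun j0 : 'I_k => (j0.+1).-tuple (univ A)) a))
         && (v == inl (Tagged (fun j0 : 'I_k => (j0.+1).-tuple (univ A))
                              (proj i a)))]
  | inr (existT R (existT j i)) =>
      [exists a : (ar R).-tuple (univ A),
         [&& a \in srel A R,
             isC u (Tagged (fun R0 => (ar R0).-tuple (univ A)) a) &
             v == inl (Tagged (fun j0 : 'I_k => (j0.+1).-tuple (univ A))
                              (proj i a))]]
  end.

Definition star_rel (r : sym (sigstar s k)) : {set (ar r).-tuple star_univ} :=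
  match r as r0 return {set (@ar (sigstar s k) r0).-tuple star_univ} with
  | inl r' => [set t : 1.-tuple star_univ | unary_holds r' (tnth t ord0)]
  | inr r' => [set t : 2.-tuple star_univ |
                 binary_holds r' (tnth t ord0) (tnth t ord_max)]
  end.

Definition star : structure (sigstar s k) := Struct star_univ star_rel.

End Star.

(* Main.v *)
(**
Solvability of the basic linear relaxation of [Y -> Z] is a transitive relation
(multiply the two stochastic matrices).  It contains homomorphisms, and it
contains [equiv1]: distribute each vertex uniformly over the vertices of its
stable colour.  Hence a chain from [X*] to [A*] yields a solution from [X*] to
[A*], and this reads as a Sherali-Adams solution: push the distribution of a
tuple enumerating [V] forward to partial maps on [V], marginalization being
consistent because the relations of [X*] record the projections between tuples.

Conversely let [m] be a common denominator of a Sherali-Adams solution.  Every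
distribution becomes a labelling of ['I_m], and for each constraint of [X*] the
labelling of the constraint and that of each of its vertices have equal fibres,
so they differ by a permutation.  Twisting the trivial [m]-fold covering of [X*]
by these permutations gives a covering that maps to [A*] by the labels.  Any two
[m]-fold coverings are [equiv1], since colours are those of the base, and [X*]
embeds in the trivial one.
*)
Require Import Defs.
From HB Require Import structures.
From mathcomp Require Import all_boot all_order all_fingroup all_algebra.
From mathcomp Require Import finmap multiset.
Set Implicit Arguments. Unset Strict Implicit. Unset Printing Implicit Defensive.
Import Order.TTheory GRing.Theory Num.Theory.

(** * Sequences and finite counting *)

Lemma pmap_filter_isSome (S T : Type) (F : S -> option T) (r : seq S) :
  pmap F r = pmap F [seq x <- r | F x].
Proof. by elim: r => //= x r IH; case E: (F x) => [y|] //=; rewrite E /= IH. Qed.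

(** Serves to compare neighbour lists: [pmap] drops the vertices where [F] is undefined, so
    agreement on the support is enough. *)
Lemma perm_pmap_supp (S T : eqType) (F : S -> option T) (r1 r2 : seq S) :
  uniq r1 -> uniq r2 -> (forall x, F x -> (x \in r1) = (x \in r2)) ->
  perm_eq (pmap F r1) (pmap F r2).
Proof.
move=> u1 u2 eq12; rewrite pmap_filter_isSome [pmap F r2]pmap_filter_isSome.
apply: perm_pmap; apply: uniq_perm; rewrite ?filter_uniq // => x.
by rewrite !mem_filter; case Fx: (F x) => //=; apply: eq12; rewrite Fx.
Qed.

Lemma map_pmap (S T U : Type) (h : T -> U) (F : S -> option T) (r : seq S) :
  map h (pmap F r) = pmap (omap h \o F) r.
Proof. by elim: r => //= x r <-; case: (F x). Qed.

Lemma onth_index (T : eqType) (x : T) (r : seq T) :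
  x \in r -> onth r (index x r) = Some x.
Proof. by move=> xr; rewrite onthE (nth_map x) ?index_mem // nth_index. Qed.

Lemma onth_tupleP (n : nat) (T : Type) (a : n.-tuple T) (i : nat) (x : T) :
  onth a i = Some x -> exists2 i' : 'I_n, i = i' & tnth a i' = x.
Proof.
move=> ai; have lt_i : (i < n)%N by rewrite -[X in (_ < X)%N](size_tuple a) -onthTE ai.
by exists (Ordinal lt_i) => //; apply/tnth_onth.
Qed.

Lemma count_mem_tuple (T : finType) (m : nat) (t : m.-tuple T) (a : T) :
  count_mem a t = #|[set l | tnth t l == a]|.
Proof.
rewrite cardsE cardE size_filter -[in LHS](map_tnth_enum t) count_map -enumT.
by apply: eq_count.
Qed.

Local Open Scope ring_scope.

Lemma card_fiber_comp (L T U : finType) (G : L -> T) (phi : T -> U) (a : U) :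
  #|[set l | phi (G l) == a]| = (\sum_(f | phi f == a) #|[set l | G l == f]|)%N.
Proof.
rewrite -sum1dep_card (partition_big G (fun f => phi f == a)) //=.
apply: eq_bigr => f /eqP fa; rewrite -sum1dep_card; apply: eq_bigl => l.
by case: (G l =P f) => [->|]; rewrite ?fa ?eqxx ?andbF.
Qed.

(** Concatenate [n t] copies of each [t] and read the resulting list as a function of the
    position. *)
Lemma labelling_with_fibers (T : finType) (n : T -> nat) :
  exists F : 'I_(\sum_t n t) -> T, forall t, #|[set l | F l == t]| = n t.
Proof.
pose r := flatten [seq nseq (n t) t | t <- enum T].
have sz : size r = (\sum_t n t)%N.
  rewrite size_flatten /shape -map_comp sumnE big_map big_enum /=.
  by apply: eq_bigr => t _; rewrite size_nseq.
rewrite -sz; exists (tnth (in_tuple r)) => t; rewrite -count_mem_tuple /= /r.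
rewrite count_flatten -map_comp sumnE big_map big_enum /= (bigD1 t) //=.
rewrite count_nseq /= eqxx mul1n big1 ?addn0 // => t' /negPf ne.
by rewrite count_nseq /= ne.
Qed.

(** Take the product of all denominators. Nonnegativity is asked value by value, because a
    Sherali-Adams solution is only constrained on partial maps with the right domain. *)
Lemma common_denominator (T : finType) (h : T -> rat) :
  exists2 m : nat, (0 < m)%N & forall t, 0 <= h t -> exists n : nat, m%:R * h t = n%:R.
Proof.
exists (\prod_t `|denq (h t)|)%N.
  by rewrite prodn_gt0 // => t; rewrite absz_gt0 denq_eq0.
move=> t h_ge0; exists (`|numq (h t)| * \prod_(t' | t' != t) `|denq (h t')|)%N.
have numE : `|denq (h t)|%N%:R * h t = `|numq (h t)|%N%:R.
  rewrite !natr_absz gtr0_norm ?denq_gt0 // ger0_norm ?numq_ge0 //.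
  by rewrite -{2}[h t]divq_num_den mulrCA divff ?mulr1 // intr_eq0 denq_eq0.
by rewrite (bigD1 t) //= natrM natrM mulrAC numE.
Qed.

Local Close Scope ring_scope.

(** * Coverings and colour refinement *)

Section Colors.
Variables (s : sig) (Y : structure s).

Lemma edge_labelC (v w : fvert Y) : edge_label v w = edge_label w v.
Proof. by case: v w => [x|c] [y|d]. Qed.

Definition colored_neighbors (j : nat) (v w : fvert Y) :
    option (label s * color s j) :=
  omap (fun l => (l, @delta s Y j w)) (edge_label v w).

Lemma deltaS (j : nat) (v : fvert Y) :
  @delta s Y j.+1 v = seq_mset (pmap (colored_neighbors j v) (enum (fvert Y))).
Proof. by []. Qed.

End Colors.

(* A covering: each neighbour [w'] of [w] lifts to exactly one neighbour of
   [e (w, l)], namely [e (w', tau w w' l)]. *)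
Lemma delta_cover (s : sig) (X Y : structure s) (L : finType)
    (e : fvert X * L -> fvert Y) (tau : fvert X -> fvert X -> L -> L) :
  bijective e ->
  (forall w l, (if e (w, l) is inl _ then true else false) =
               (if w is inl _ then true else false)) ->
  (forall w l w' l', edge_label (e (w, l)) (e (w', l')) =
     if l' == tau w w' l then edge_label w w' else None) ->
  forall j w l, @delta s Y j (e (w, l)) = @delta s X j w.
Proof.
move=> bij_e side_e edge_e; have [d eK dK] := bij_e.
elim=> [|j IH] w l; first exact: side_e.
rewrite !deltaS; apply/eq_seq_msetP.
pose h w' := e (w', tau w w' l).
have inj_h : injective h by move=> w1 w2 /(can_inj eK) [].
have -> : pmap (colored_neighbors j w) (enum (fvert X)) =
          pmap (colored_neighbors j (e (w, l))) (map h (enum (fvert X))).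
  elim: (enum _) => //= w' r ->; rewrite /colored_neighbors edge_e eqxx.
  by case: edge_label => //= a; rewrite IH.
apply: perm_pmap_supp; rewrite ?map_inj_uniq -?enumT ?enum_uniq // => v.
rewrite mem_enum; rewrite -(dK v); case: (d v) => w' l'.
rewrite /colored_neighbors edge_e; case: eqP => //= -> _.
by rewrite mem_map ?mem_enum.
Qed.

Section Coverings.
Variables (s : sig) (X : structure s) (m : nat).
Hypothesis ar_pos : forall R : sym s, 0 < ar R.
Local Notation tagged_tuple := {R : sym s & (ar R).-tuple (univ X)}.
Implicit Type pi : tagged_tuple -> univ X -> 'S_m.

(** The sheet index [l] belongs to the constraint, and [pi] tells in which sheet each of its
    vertices lies. The permutation depends on the vertex and not on the position, so repeated
    entries stay equal and edge labels are preserved. *)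
Definition lift_tuple pi (R : sym s) (t : (ar R).-tuple (univ X)) (l : 'I_m) :
    (ar R).-tuple (univ X * 'I_m) :=
  map_tuple (fun x => (x, pi (Tagged (fun R => (ar R).-tuple (univ X)) t) x l)) t.

Definition cover pi : structure s :=
  @Struct s (univ X * 'I_m)%type
    (fun R => [set lift_tuple pi t l | t in srel X R, l in 'I_m]).

Lemma lift_in pi (c : constr X) (l : 'I_m) :
  tagged (Tagged (fun R => (ar R).-tuple (univ (cover pi)))
            (lift_tuple pi (tagged (val c)) l)) \in
  srel (cover pi) (tag (val c)).
Proof. by apply/imset2P; exists (tagged (val c)) l => //; apply: (valP c). Qed.

Definition lift_constr pi (c : constr X) (l : 'I_m) : constr (cover pi) :=
  exist _ (Tagged (fun R => (ar R).-tuple (univ (cover pi)))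
            (lift_tuple pi (tagged (val c)) l)) (lift_in pi c l).

Definition lift_vert pi (wl : fvert X * 'I_m) : fvert (cover pi) :=
  match wl with
  | (inl x, l) => inl (x, l)
  | (inr c, l) => inr (lift_constr pi c l)
  end.

(** First components recover the base tuple; the sheet is then read off at position 0, which exists
    by [ar_pos], since permutations are injective. *)
Lemma lift_constr_inj pi c c' l l' :
  lift_constr pi c l = lift_constr pi c' l' -> c = c' /\ l = l'.
Proof.
case: c c' => [[R t] Ht] [[R' t'] Ht'] E.
have {E} := congr1 val E => /= E.
have ER := congr1 tag E; simpl in ER.
case: _ / ER in t' Ht' E *.
have {}E : lift_tuple pi t l = lift_tuple pi t' l' by move/eqP: E; rewrite eq_Tagged => /eqP.
have Et : t = t'.
  apply: val_inj; move/(congr1 (fun u => map fst (val u))): E => /=.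
  by rewrite -!map_comp /= !map_id.
subst t'; split; first exact: val_inj.
move/(congr1 (fun u => (tnth u (Ordinal (ar_pos R))).2)): E.
by rewrite !tnth_map /= => /perm_inj.
Qed.

Lemma lift_vert_bij pi : bijective (lift_vert pi).
Proof.
have inj : injective (lift_vert pi).
  move=> [[x|c] l] [[x'|c'] l'] //=; first by case=> -> ->.
  by move=> E; have /lift_constr_inj [-> ->] : lift_constr pi c l = lift_constr pi c' l'
    by apply: inr_inj E.
have surj v : exists w, lift_vert pi w == v.
  case: v => [[x l]|[[R u] Hu]]; first by exists (inl x, l).
  have /imset2P [t l Ht _ Eu] := Hu; simpl in Eu.
  exists (inr (exist _ (Tagged (fun R => (ar R).-tuple (univ X)) t) Ht), l).
  by apply/eqP; congr inr; apply: val_inj; rewrite /= Eu.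
exists (fun v => xchoose (surj v)) => [w|v]; last exact/eqP/(xchooseP (surj v)).
by apply: inj; apply/eqP/(xchooseP (surj _)).
Qed.

Lemma edge_lift pi x l c l' :
  edge_label (lift_vert pi (inl x, l)) (lift_vert pi (inr c, l')) =
  if l == pi (val c) x l' then edge_label (inl x : fvert X) (inr c) else None.
Proof.
case: c => [[R t] Ht] /=; rewrite !inE /=.
have memE : ((x, l) \in [seq (y, pi (Tagged (fun R => (ar R).-tuple (univ X)) t) y l') | y <- t]) =
   (l == pi (Tagged (fun R => (ar R).-tuple (univ X)) t) x l') && (x \in (t : seq _)).
  apply/mapP/andP => [[y yt [-> ->]]|[/eqP -> xt]]; first by rewrite eqxx.
  by exists x.
rewrite memE; case: eqP => //= E; case: ifP => // xt.
congr (Some (Tagged _ _)); apply/setP => i; rewrite !inE tnth_map E.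
by rewrite xpair_eqE; case: eqP => [->|] //=; rewrite eqxx.
Qed.

Definition fiber_shift pi (w w' : fvert X) (l : 'I_m) : 'I_m :=
  match w, w' with
  | inl x, inr c => ((pi (val c) x)^-1)%g l
  | inr c, inl x => pi (val c) x l
  | _, _ => l
  end.

Lemma delta_lift pi j w l :
  @delta s (cover pi) j (lift_vert pi (w, l)) = @delta s X j w.
Proof.
apply: (delta_cover (tau := fiber_shift pi)); first exact: lift_vert_bij.
  by case.
move=> [x|c] {}l [x'|c'] l'; try by rewrite /= if_same.
  rewrite edge_lift /=; congr (if _ then _ else _).
  by apply/eqP/eqP => ->; rewrite ?permK ?permKV.
by rewrite edge_labelC edge_lift edge_labelC.
Qed.

(** Match the lifts of the same base vertex in the same sheet; both carry the colours of that
    vertex. *)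
Lemma equiv1_cover pi1 pi2 : equiv1 (cover pi1) (cover pi2).
Proof.
have [d1 eK1 dK1] := lift_vert_bij pi1; have [d2 eK2 dK2] := lift_vert_bij pi2.
exists (fun v => lift_vert pi2 (d1 v)); split.
  exists (fun v => lift_vert pi1 (d2 v)) => v; by rewrite ?eK1 ?eK2 ?dK1 ?dK2.
by move=> v j; rewrite -{1}(dK1 v); case: (d1 v) => w l; rewrite !delta_lift.
Qed.

End Coverings.
Arguments cover {s} X {m} pi.

(* An integral form of the linear relaxation: all probabilities have
   denominator [m], so a distribution is a labelling of ['I_m].  The
   permutations matching the two labellings of each vertex twist the trivial
   [m]-fold covering into one that maps to [A]. *)
Lemma labelling_cover (s : sig) (ar_pos : forall R : sym s, 0 < ar R)
    (X A : structure s) (m : nat) (lab : univ X -> 'I_m -> univ A)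
    (g : {R : sym s & (ar R).-tuple (univ X)} -> 'I_m -> univ X -> univ A) :
  0 < m ->
  (forall (R : sym s) (t : (ar R).-tuple (univ X)) l, t \in srel X R ->
     map_tuple (g (Tagged (fun R => (ar R).-tuple (univ X)) t) l) t \in srel A R) ->
  (forall (R : sym s) (t : (ar R).-tuple (univ X)) x a, t \in srel X R ->
     x \in (t : seq _) ->
     #|[set l | g (Tagged (fun R => (ar R).-tuple (univ X)) t) l x == a]| =
     #|[set l | lab x l == a]|) ->
  exists Y1 Y2 : structure s, homto X Y1 /\ equiv1 Y1 Y2 /\ homto Y2 A.
Proof.
move=> m_gt0 g_rel g_lab.
(* The membership conditions sit under the existential, so that a permutation exists for every pair
   and finite choice yields a total [pi]. *)
have match_perm (c : {R : sym s & (ar R).-tuple (univ X)}) x : exists p : 'S_m,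
    tagged c \in srel X (tag c) -> x \in tval (tagged c) ->
    forall l, lab x (p l) = g c l x.
  case ht : (tagged c \in srel X (tag c)); last by exists 1%g.
  case hx : (x \in tval (tagged c)); last by exists 1%g.
  (* Equal fibre sizes say that the two label tuples have the same multiplicities. *)
  have : perm_eq [tuple g c l x | l < m] [tuple lab x l | l < m].
    have count_fiber (h : 'I_m -> univ A) a :
        count_mem a [tuple h l | l < m] = #|[set l | h l == a]|.
      by rewrite count_mem_tuple; apply: eq_card => l; rewrite !inE tnth_mktuple.
    apply/allP => a _; rewrite /= !count_fiber.
    by case: c ht hx => R t /= ht hx; rewrite g_lab.
  case/tuple_permP => p E; exists p => _ _ l.
  have := congr1 (fun r : seq (univ A) => nth (lab x l) r l) E.
  by rewrite -!tnth_nth !tnth_mktuple.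
have [pi piP] := fin_all_exists (fun c => fin_all_exists (match_perm c)).
exists (cover X (fun _ _ => 1%g : 'S_m)), (cover X pi); split; last split.
- exists (fun x => (x, Ordinal m_gt0)) => R t ht.
  apply/imset2P; exists t (Ordinal m_gt0) => //.
  by apply: eq_from_tnth => i; rewrite !tnth_map perm1.
- exact: equiv1_cover.
exists (fun xl => lab xl.1 xl.2) => R _ /imset2P [t l ht _ ->].
(* Over [x] the lifted tuple lies in the sheet that [pi] assigns to [l], whose label is the value of
   [g] at [l] and [x]. *)
have -> : map_tuple (fun xl => lab xl.1 xl.2) (lift_tuple pi t l) =
    map_tuple (g (Tagged (fun R => (ar R).-tuple (univ X)) t) l) t.
  by apply: eq_from_tnth => i; rewrite !tnth_map /= piP //= mem_tnth.
exact: g_rel.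
Qed.

Local Open Scope ring_scope.

(** * Fractional homomorphisms *)

Definition entries (s : sig) (Y : structure s) (c : constr Y) : seq (univ Y) :=
  tval (tagged (val c)).

Lemma size_entries (s : sig) (Y : structure s) (c : constr Y) :
  size (entries c) = ar (tag (val c)).
Proof. exact: size_tuple. Qed.

(* [p] and [q] solve the basic linear relaxation of [Y -> Z].  The relaxation
   also asks a constraint with repeated entries to be sent to tuples with the
   same repetitions; this is omitted because in a starred structure the unary
   relations [T_{j,S}] and [R_S] already enforce it. *)
Record frac_hom (s : sig) (Y Z : structure s)
    (p : univ Y -> univ Z -> rat) (q : constr Y -> constr Z -> rat) : Prop :=
  FracHom {
    frac_ge0 : forall y z, 0 <= p y z;
    frac_mass_ge0 : forall c d, 0 <= q c d;
    frac_sum : forall y, \sum_z p y z = 1;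
    frac_supp : forall c d, q c d != 0 -> tag (val d) = tag (val c);
    frac_marg : forall c i y z, onth (entries c) i = Some y ->
      p y z = \sum_(d | onth (entries d) i == Some z) q c d }.

Definition frac_homto (s : sig) (Y Z : structure s) : Prop :=
  exists p q, @frac_hom s Y Z p q.

(** A homomorphism is a deterministic solution: the 0-1 matrices of [f] and of the map [fc] it
    induces on constraints. *)
Lemma homto_frac (s : sig) (Y Z : structure s) : homto Y Z -> frac_homto Y Z.
Proof.
case=> f f_rel.
pose fc (c : constr Y) : constr Z :=
  exist (fun d : {R : sym s & (ar R).-tuple (univ Z)} => tagged d \in srel Z (tag d))
    (Tagged (fun R => (ar R).-tuple (univ Z)) (map_tuple f (tagged (val c))))
    (f_rel _ _ (valP c)).
exists (fun y z => (f y == z)%:R), (fun c d => (fc c == d)%:R); split.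
- by move=> y z; rewrite ler0n.
- by move=> c d; rewrite ler0n.
- move=> y; rewrite (bigD1 (f y)) //= eqxx big1 ?addr0 // => z.
  by move/negPf; rewrite eq_sym => ->.
- by move=> c d; case: (fc c =P d) => [<-|_] //; rewrite eqxx.
move=> c i y z cy; rewrite big_mkcond (bigD1 (fc c)) //= eqxx big1 ?addr0; last first.
  by move=> d /negPf; rewrite eq_sym => ->; rewrite if_same.
have -> : onth (entries (fc c)) i = Some (f y).
  by rewrite [entries _]/= onth_map cy.
by rewrite (inj_eq (@Some_inj _)); case: eqP.
Qed.

Lemma homto_refl (s : sig) (Y : structure s) : homto Y Y.
Proof.
exists id => R t; rewrite (_ : map_tuple _ t = t) //.
by apply: val_inj; rewrite /= map_id.
Qed.

Lemma frac_homto_trans (s : sig) (Y Z W : structure s) :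
  frac_homto Y Z -> frac_homto Z W -> frac_homto Y W.
Proof.
case=> p1 [q1 [p1_ge0 q1_ge0 p1_sum q1_supp p1_marg]] [p2 [q2 [p2_ge0 q2_ge0 p2_sum q2_supp p2_marg]]].
exists (fun y w => \sum_z p1 y z * p2 z w), (fun c e => \sum_d q1 c d * q2 d e).
split.
- by move=> y w; apply: sumr_ge0 => z _; apply: mulr_ge0.
- by move=> c e; apply: sumr_ge0 => d _; apply: mulr_ge0.
- move=> y; rewrite exchange_big /= -(p1_sum y); apply: eq_bigr => z _.
  by rewrite -mulr_sumr p2_sum mulr1.
- move=> c e; apply: contra_neq_eq => ne_tag; rewrite big1 // => d _.
  have [->|/q1_supp cd] := eqVneq (q1 c d) 0; first by rewrite mul0r.
  have [->|/q2_supp de] := eqVneq (q2 d e) 0; first by rewrite mulr0.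
  by rewrite de cd eqxx in ne_tag.
move=> c i y w cy; rewrite exchange_big /=.
have i_lt : (i < ar (tag (val c)))%N.
  by rewrite -size_entries -onthTE cy.
under [RHS]eq_bigr do rewrite -mulr_sumr.
transitivity (\sum_z \sum_(d | onth (entries d) i == Some z) q1 c d * p2 z w).
  by apply: eq_bigr => z _; rewrite (p1_marg c i) // mulr_suml.
rewrite (exchange_big_dep xpredT) //=; apply: eq_bigr => d _.
have [->|/q1_supp cd] := eqVneq (q1 c d) 0.
  by rewrite mul0r big1 // => z _; rewrite mul0r.
(* A constraint [d] in the support of [q1 c] has the symbol of [c], hence an entry [z] at position
   [i]; only this [z] contributes. *)
have : onth (entries d) i by rewrite onthTE size_entries cd.
case dz : (onth (entries d) i) => [z|] // _.
rewrite (big_pred1 z) => [|z' /=]; last by rewrite eq_sym (inj_eq (@Some_inj _)).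
by rewrite (p2_marg d i z).
Qed.

(** * Stabilization of colour refinement *)

Section Stabilization.
Variable s : sig.
Hypothesis ar_pos : forall R : sym s, (0 < ar R)%N.

(* At level 0: a neighbour lies on the other side, and as arities are positive
   a vertex without neighbours is an element. *)
Fixpoint color_pred (j : nat) : color s j.+1 -> color s j :=
  match j return color s j.+1 -> color s j with
  | 0 => fun m : multiset (label s * bool)%type => if (m : seq _) is x :: _ then ~~ x.2 else true
  | j'.+1 => fun m : multiset (label s * color s j'.+1)%type =>
      seq_mset [seq (x.1, color_pred x.2) | x <- (m : seq _)]
  end.

(** Each colour determines the previous one, so refinement only splits colour classes. *)
Lemma delta_pred (Y : structure s) (j : nat) (v : fvert Y) :
  color_pred (@delta s Y j.+1 v) = @delta s Y j v.
Proof.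
elim: j v => [|j IH] v; last first.
  rewrite [color_pred _]/= [RHS]deltaS; apply/eq_seq_msetP.
  apply: perm_trans (perm_map _ (perm_eq_seq_mset _)) _.
  apply/eq_seq_msetP; congr seq_mset.
  rewrite map_pmap; apply: eq_pmap => w; rewrite /comp /colored_neighbors.
  by case: (edge_label v w) => // a; rewrite -IH.
rewrite deltaS; set r := pmap _ _.
have mem_r : (seq_mset r : seq _) =i r.
  by apply: perm_mem; apply: perm_eq_seq_mset.
have sides x : x \in r -> x.2 = ~~ @delta s Y 0 v.
  rewrite mem_pmap => /mapP [w _]; rewrite /colored_neighbors.
  by case: v w {r mem_r} => [y|c] [z|d] //=; case: ifP => // _ [->].
case E : (seq_mset r : seq _) => [|x m]; rewrite /= E; last first.
  by rewrite sides ?negbK // -mem_r E mem_head.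
case: v @r mem_r {sides} E => [y|c] // r mem_r E.
(* A constraint cannot have an empty multiset of neighbours: its first entry is one. *)
pose y := tnth (tagged (val c)) (Ordinal (ar_pos (tag (val c)))).
have yc : y \in scope c by rewrite inE mem_tnth.
have : (mk_label y c, true) \in r.
  rewrite mem_pmap; apply/mapP; exists (inl y); first by rewrite mem_enum.
  by rewrite /colored_neighbors /= yc.
by rewrite -mem_r E.
Qed.

Definition joint_delta (Y Z : structure s) (j : nat) (u : fvert Y + fvert Z) :
    color s j :=
  match u with inl v => @delta s Y j v | inr w => @delta s Z j w end.

(** The relations [E j] of equal colour form a decreasing chain of subsets of a finite set, so two
    consecutive ones coincide. Taking both structures jointly gives one level that serves
    comparisons within [Z] and between [Y] and [Z]. *)
Lemma joint_delta_stable (Y Z : structure s) : exists J : nat,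
  forall v w : (fvert Y + fvert Z)%type,
    joint_delta J v = joint_delta J w -> joint_delta J.+1 v = joint_delta J.+1 w.
Proof.
pose E j := [set vw : (fvert Y + fvert Z) * (fvert Y + fvert Z) |
  @joint_delta Y Z j vw.1 == joint_delta j vw.2].
have subE j : E j.+1 \subset E j.
  apply/subsetP => -[v w]; rewrite !inE /= => /eqP H; apply/eqP.
  have {H} := congr1 (@color_pred j) H.
  by case: v w => v [] w /=; rewrite !delta_pred.
have [J leJ] : exists J, (#|E J| <= #|E J.+1|)%N.
  suff H n j : (#|E j| <= n)%N -> exists J, (#|E J| <= #|E J.+1|)%N by exact: H 0%N (leqnn _).
  elim: n j => [|n IH] j le_n; first by exists j; apply: leq_trans le_n _.
  have [|lt] := leqP #|E j| #|E j.+1|; first by exists j.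
  by apply: (IH j.+1); rewrite -ltnS (leq_trans lt).
exists J => v w eqJ.
have /eqP EJ : E J.+1 == E J by rewrite eqEcard subE.
have : (v, w) \in E J by rewrite inE /=; apply/eqP.
by rewrite -EJ inE => /eqP.
Qed.

End Stabilization.

(** * Reading positions and neighbour counts off colours *)

Section Labels.
Variable s : sig.

Definition label_at (l : label s) (i : nat) : bool :=
  if insub i is Some i' then i' \in tagged l else false.

Lemma mk_label_at (Y : structure s) (y : univ Y) (c : constr Y) (i : nat) :
  label_at (mk_label y c) i = (onth (entries c) i == Some y).
Proof.
rewrite /label_at /=; case: insubP => [i' _ <-|].
  rewrite inE /entries; apply/eqP/eqP; first by move/tnth_onth.
  by move=> H; apply/tnth_onth.
rewrite -leqNgt -size_entries => /onth_default ->.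
by [].
Qed.

(** Both sides are the multiplicity of [(l, a)] in the common colour of level [j.+1]. *)
Lemma neighbor_count (Y Z : structure s) (j : nat) (v : fvert Y) (w : fvert Z)
    (l : label s) (a : color s j) :
  @delta s Y j.+1 v = @delta s Z j.+1 w ->
  #|[set v' | (edge_label v v' == Some l) && (@delta s Y j v' == a)]| =
  #|[set w' | (edge_label w w' == Some l) && (@delta s Z j w' == a)]|.
Proof.
have count_nbrs (W : structure s) (u : fvert W) :
    count_mem (l, a) (pmap (colored_neighbors j u) (enum (fvert W))) =
    #|[set u' | (edge_label u u' == Some l) && (@delta s W j u' == a)]|.
  rewrite cardsE cardE size_filter -enumT; elim: (enum _) => //= u' r <-.
  rewrite unfold_in [colored_neighbors j u u']/colored_neighbors.
  by case: (edge_label u u').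
rewrite !deltaS -!count_nbrs => /eq_seq_msetP /seq.permP; exact.
Qed.

End Labels.

(** * Colour equivalence yields a fractional homomorphism *)

Section EquivFrac.
Variable s : sig.
Hypothesis ar_pos : forall R : sym s, (0 < ar R)%N.

Definition elem_color (Y : structure s) (J : nat) (y : univ Y) : color s J :=
  @delta s Y J (inl y).
Definition constr_color (Y : structure s) (J : nat) (c : constr Y) : color s J :=
  @delta s Y J (inr c).

Lemma color_neighbor (Y Z : structure s) (J : nat) (v : fvert Y) (w : fvert Z) v' l :
  @delta s Y J.+1 v = @delta s Z J.+1 w -> edge_label v v' = Some l ->
  exists2 w', edge_label w w' = Some l & @delta s Z J w' = @delta s Y J v'.
Proof.
move=> eq_vw vv'.
have : (0 < #|[set w' | (edge_label w w' == Some l) &&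
               (@delta s Z J w' == @delta s Y J v')]|)%N.
  rewrite -(neighbor_count _ _ eq_vw) card_gt0; apply/set0Pn; exists v'.
  by rewrite inE vv' !eqxx.
by rewrite card_gt0 => /set0Pn [w']; rewrite inE => /andP [/eqP ? /eqP ?]; exists w'.
Qed.

(** The edge label records the symbol and all positions of [y], so a neighbour of [d] with this
    label sits at the same position. *)
Lemma equiv_constr (Y Z : structure s) (J : nat) (c : constr Y) (d : constr Z) i y :
  @delta s Y J.+1 (inr c) = @delta s Z J.+1 (inr d) -> onth (entries c) i = Some y ->
  exists z, [/\ onth (entries d) i = Some z, tag (val d) = tag (val c),
     edge_label (inl z : fvert Z) (inr d) = Some (mk_label y c) &
     elem_color J z = elem_color J y].
Proof.
move=> eq_cd cy.
have edge_cy : edge_label (inr c : fvert Y) (inl y) = Some (mk_label y c).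
  by rewrite /= inE; case: ifP => // /onthP []; exists i.
have [[z|d'] //] := color_neighbor eq_cd edge_cy.
move=> edge_dz eq_col; exists z.
have eq_lab : mk_label z d = mk_label y c.
  by move: edge_dz; rewrite /=; case: ifP => // _ [].
split=> //; last exact: (congr1 tag eq_lab).
by apply/eqP; rewrite -mk_label_at eq_lab mk_label_at cy.
Qed.

(** With uniform distributions on the classes of a stable level [J], the marginal condition becomes
    the double count [Nc c = Ny y * M z]. *)
Lemma equiv1_frac (Y Z : structure s) : equiv1 Y Z -> frac_homto Y Z.
Proof.
case=> phi [_ phi_delta]; have [J stable] := joint_delta_stable ar_pos Y Z.
have stableYZ v w : @delta s Y J v = @delta s Z J w ->
    @delta s Y J.+1 v = @delta s Z J.+1 w by exact: (stable (inl v) (inr w)).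
have stableZZ v w : @delta s Z J v = @delta s Z J w ->
    @delta s Z J.+1 v = @delta s Z J.+1 w by exact: (stable (inr v) (inr w)).
pose Ny y := #|[set z : univ Z | elem_color J z == elem_color J (y : univ Y)]|.
pose Nc c := #|[set d : constr Z | constr_color J d == constr_color J (c : constr Y)]|.
(* The class is inhabited by the image under [phi], which is an element again by the colour at level
   0. *)
have Ny_gt0 y : (0 < Ny y)%N.
  have := phi_delta (inl y); case E : (phi (inl y)) => [z|d] H; last first.
    by have := H 0%N.
  by apply/card_gt0P; exists z; rewrite inE; apply/eqP; rewrite /elem_color H.
have Nc_gt0 c : (0 < Nc c)%N.
  have := phi_delta (inr c); case E : (phi (inr c)) => [z|d] H.
    by have := H 0%N.
  by apply/card_gt0P; exists d; rewrite inE; apply/eqP; rewrite /constr_color H.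
exists (fun y z => (elem_color J z == elem_color J y)%:R / (Ny y)%:R),
  (fun c d => (constr_color J d == constr_color J c)%:R / (Nc c)%:R).
split.
- by move=> y z; rewrite divr_ge0 ?ler0n.
- by move=> c d; rewrite divr_ge0 ?ler0n.
- move=> y; rewrite -mulr_suml -natr_sum.
  rewrite (_ : (\sum_z _)%N = Ny y); last first.
    by rewrite /Ny -sum1dep_card [RHS]big_mkcond; apply: eq_bigr => z _; case: (_ == _).
  by rewrite divff // pnatr_eq0 -lt0n.
- move=> c d; case: (constr_color J d =P _) => [E _|_]; last by rewrite mul0r eqxx.
  have ic : (0 < size (entries c))%N by rewrite size_entries.
  case cy : (onth (entries c) 0) => [y|]; last by rewrite -onthTE cy in ic.
  by have [z []] := equiv_constr (stableYZ (inr c) (inr d) (esym E)) cy.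
move=> c i y z cy.
rewrite -mulr_suml -natr_sum.
pose M z := #|[set d : constr Z | (onth (entries d) i == Some z) &&
   (constr_color J d == constr_color J c)]|.
have -> : (\sum_(d : constr Z | onth (entries d) i == Some z)
    (constr_color J d == constr_color J c))%N = M z.
  rewrite /M -sum1dep_card big_mkcondr; apply: eq_bigr => d _.
  by case: (_ == _).
have [eq_zy|ne_zy] := eqVneq (elem_color J z) (elem_color J y); last first.
  rewrite mul0r; suff -> : M z = 0%N by rewrite mul0r.
  apply/eqP; rewrite cards_eq0; apply/eqP/setP => d; rewrite !inE.
  apply/negP => /andP [/eqP dz /eqP cd].
  have [z' []] := equiv_constr (stableYZ (inr c) (inr d) (esym cd)) cy.
  by rewrite dz => -[<-] _ _ E; rewrite E eqxx in ne_zy.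
(* Rewritten as a count of neighbours of [z'], so that stability makes it constant on the colour
   class. *)
have ME z' : elem_color J z' = elem_color J y ->
    M z' = #|[set v : fvert Z | (edge_label (inl z') v == Some (mk_label y c)) &&
      (@delta s Z J v == constr_color J c)]|.
  move=> eq_z'y; rewrite /M -(card_imset _ (@inr_inj (univ Z) (constr Z))).
  apply: eq_card => v; rewrite !inE; apply/imsetP/andP.
    case=> d; rewrite inE => /andP [/eqP dz' /eqP cd] ->.
    have [z'' []] := equiv_constr (stableYZ (inr c) (inr d) (esym cd)) cy.
    by rewrite dz' => -[<-] _ -> _; rewrite [delta J _]cd !eqxx.
  case: v => [w|d] [] /eqP //= edge_d /eqP cd; exists d => //.
  rewrite inE [constr_color J d]cd eqxx andbT.
  have : mk_label z' d = mk_label y c by case: ifP edge_d => // _ [].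
  by move/(congr1 (fun l => label_at l i)); rewrite !mk_label_at cy eqxx => ->.
have Mconst z' : elem_color J z' = elem_color J y -> M z' = M z.
  move=> eq_z'y; rewrite !ME //; apply: neighbor_count; apply: stableZZ.
  exact: etrans eq_z'y (esym eq_zy).
(* Count the pairs of a constraint [d] coloured like [c] and its entry at position [i]: that entry
   is unique and has the colour of [y]. *)
have NM : Nc c = (Ny y * M z)%N.
  rewrite /Ny -sum1dep_card big_distrl /=.
  under [RHS]eq_bigr => z' /eqP eq_z' do rewrite mul1n -(Mconst z') // /M -sum1dep_card.
  rewrite (exchange_big_dep (fun d => constr_color J d == constr_color J c)) /=; last first.
    by move=> z' d _ /andP [].
  rewrite /Nc -sum1dep_card; apply: eq_bigr => d /eqP cd.
  have [z' [dz' _ _ eq_z']] := equiv_constr (stableYZ (inr c) (inr d) (esym cd)) cy.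
  rewrite (big_pred1 z') // => z'' /=; rewrite dz' cd eqxx andbT (inj_eq (@Some_inj _)).
  by rewrite [z' == _]eq_sym; case: (z'' =P z') => [->|_]; rewrite ?eq_z' ?eqxx ?andbF.
rewrite NM natrM invfM mulrCA mul1r divff ?mulr1 // pnatr_eq0.
by apply/eqP => M0; have := Nc_gt0 c; rewrite NM M0 muln0.
Qed.

End EquivFrac.

(** * Starred structures *)

Section StarElements.
Variables (s : sig) (k : nat).

Definition elts (Y : structure s) (u : star_univ k Y) : seq (univ Y) :=
  match u with inl t => tval (tagged t) | inr c => entries c end.

Definition kind (Y : structure s) (u : star_univ k Y) : 'I_k + sym s :=
  match u with inl t => inl (tag t) | inr c => inr (tag (val c)) end.

Lemma size_elts (Y Z : structure s) (u : star_univ k Y) (v : star_univ k Z) :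
  kind u = kind v -> size (elts u) = size (elts v).
Proof.
case: u v => [[j t]|c] [[j' t']|c'] //= [E]; first by rewrite !size_tuple E.
by rewrite !size_entries E.
Qed.

Lemma star_tuple_eq (Y : structure s) (j : 'I_k) (u v : star_univ k Y) :
  kind u = inl j -> kind v = inl j -> elts u = elts v -> u = v.
Proof.
case: u v => [[j1 t1]|c1] [[j2 t2]|c2] //= [E1] [E2].
by case: _ / (esym E1) in t1 *; case: _ / (esym E2) in t2 * => /val_inj ->.
Qed.

Lemma allEq_pair (n : nat) (T : eqType) (a : n.-tuple T) (i i' : 'I_n) :
  allEq a [set i; i'] = (tnth a i == tnth a i').
Proof.
apply/forall_inP/eqP => [H|E l].
  have /forall_inP/(_ i') := H i (set21 _ _).
  by rewrite set22 => /(_ isT) /eqP.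
rewrite !inE => /orP [] /eqP ->; apply/forall_inP => l'; rewrite !inE => /orP [] /eqP ->;
  by rewrite ?eqxx ?E.
Qed.

(** Relations with [S] empty fix the kind; those with [S] a pair of positions transfer the equality
    of two entries. *)
Lemma unary_transfer (Y Z : structure s) (u : star_univ k Y) (b : star_univ k Z) :
  (forall r, unary_holds r u -> unary_holds r b) ->
  kind b = kind u /\
  forall i i' x, onth (elts u) i = Some x -> onth (elts u) i' = Some x ->
    onth (elts b) i = onth (elts b) i'.
Proof.
move=> sub_ub; case: u sub_ub => [[j t]|c] sub_ub.
  have transfer (S : {set 'I_j.+1}) : allEq t S -> exists2 a : j.+1.-tuple (univ Z),
      b = inl (Tagged (fun j0 : 'I_k => (j0.+1).-tuple (univ Z)) a) & allEq a S.
    move=> tS; have /existsP [a /andP [/eqP -> aS]] : unary_holds (inl (existT _ j S)) b.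
      by apply: sub_ub; apply/existsP; exists t; rewrite eqxx.
    by exists a.
  split.
    have [|a -> //] := transfer set0.
    by apply/forall_inP => i; rewrite inE.
  move=> i i' x /(@onth_tupleP _ _ t) [l -> tl] /(@onth_tupleP _ _ t) [l' -> tl'].
  have [|a -> ] := transfer [set l; l']; first by rewrite allEq_pair tl tl'.
  rewrite allEq_pair => /eqP E /=.
  by have /tnth_onth -> := E; apply/esym/tnth_onth.
case: c sub_ub => [[R t] Rt] sub_ub.
have transfer (S : {set 'I_(ar R)}) : allEq t S -> exists a : (ar R).-tuple (univ Z),
    isC b (Tagged (fun R0 => (ar R0).-tuple (univ Z)) a) /\ allEq a S.
  move=> tS; have /existsP [a /and3P [_ ba aS]] : unary_holds (inr (existT _ R S)) b.
    by apply: sub_ub; apply/existsP; exists t; rewrite tS /= eqxx andbT Rt.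
  by exists a.
split.
  have [|a []] := transfer set0; first by apply/forall_inP => i; rewrite inE.
  by case: b {sub_ub transfer} => // d /eqP dE _; exact: (congr1 (fun x => inr (tag x)) dE).
move=> i i' x /(@onth_tupleP _ _ t) [l -> tl] /(@onth_tupleP _ _ t) [l' -> tl'].
have [|a []] := transfer [set l; l']; first by rewrite allEq_pair tl tl'.
case: b {sub_ub transfer} => // d /eqP dE.
have /= -> : elts (inr d : star_univ k Z) = a.
  exact: (congr1 (fun x => tval (tagged x)) dE).
rewrite allEq_pair => /eqP E.
by have /tnth_onth -> := E; apply/esym/tnth_onth.
Qed.

Lemma map_Some_proj (n m : nat) (T U : eqType) (a : n.-tuple T) (t : n.-tuple U)
    (t' : m.-tuple U) (i : m.-tuple 'I_n) :
  (forall l, tnth i l = index (tnth t' l) t :> nat) ->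
  map Some (proj i a) = [seq onth a (index x t) | x <- t'].
Proof.
move=> iP; rewrite -[RHS]/(tval (map_tuple _ t')) -[LHS]/(tval (map_tuple _ _)).
congr tval; apply: eq_from_tnth => l; rewrite !tnth_map tnth_ord_tuple -iP.
by apply/esym/tnth_onth.
Qed.

(* A tuple whose entries all occur in [u] is a projection of [u]; the relation
   of the signature expressing this reads in any structure as below. *)
Lemma binary_proj (X : structure s) (u w : star_univ k X) (j : 'I_k) :
  kind w = inl j -> {subset elts w <= elts u} ->
  exists r : bsym s k, forall (Y : structure s) (b b' : star_univ k Y),
    binary_holds r b b' <->
    [/\ kind b = kind u, kind b' = inl j &
        map Some (elts b') = [seq onth (elts b) (index x (elts u)) | x <- elts w]].
Proof.
case: w => [[j0 t']|] // [ej]; case: _ / ej => {j}; rename j0 into j.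
rewrite /= => sub_wu; case: u sub_wu => [[ju t]|[[R t] Rt]] /= sub_wu.
  have idx l : (index (tnth t' l) t < ju.+1)%N.
    by rewrite -[X in (_ < X)%N](size_tuple t) index_mem sub_wu ?mem_tnth.
  (* The projection picks the first occurrence in [u] of each entry of [w]. *)
  pose i := [tuple Ordinal (idx l) | l < j.+1].
  have iP l : tnth i l = index (tnth t' l) t :> nat by rewrite tnth_mktuple.
  exists (inl (existT _ ju (existT _ j i))) => Y b b'; split.
    case/existsP => a /andP [/eqP -> /eqP ->]; split=> //=.
    by rewrite (map_Some_proj a iP).
  case: b => [[ju' a] [[E]]|c []] //=; case: _ / (esym E) in a *; move=> kb' eb'.
  apply/existsP; exists a; rewrite eqxx /=; apply/eqP; apply: (star_tuple_eq kb') => //=.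
  by apply: (inj_map (@Some_inj _)); rewrite eb' (map_Some_proj a iP).
rewrite /entries /= in sub_wu *.
have idx l : (index (tnth t' l) t < ar R)%N.
  by rewrite -[X in (_ < X)%N](size_tuple t) index_mem sub_wu ?mem_tnth.
pose i := [tuple Ordinal (idx l) | l < j.+1].
have iP l : tnth i l = index (tnth t' l) t :> nat by rewrite tnth_mktuple.
exists (inr (existT _ R (existT _ j i))) => Y b b'; split.
  case/existsP => a /and3P [Ra]; case: b => // c /eqP ca /eqP ->; split=> //.
    exact: (congr1 (fun x => inr (tag x)) ca).
  have -> : elts (inr c : star_univ k Y) = a.
    exact: (congr1 (fun x => tval (tagged x)) ca).
  by rewrite /= (map_Some_proj a iP).
case: b => [? []|[[R' a] Ra] [[E]]] //=; rewrite /entries /= in E *.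
case: _ / (esym E) in a Ra *; move=> kb' eb'.
apply/existsP; exists a; rewrite eqxx Ra /=; apply/eqP; apply: (star_tuple_eq kb') => //=.
by apply: (inj_map (@Some_inj _)); rewrite eb' (map_Some_proj a iP).
Qed.

End StarElements.

Lemma sat_constr_entries (s : sig) (X A : structure s) (c : constr X) (d : constr A)
    (f : {ffun univ X -> option (univ A)}) :
  tag (val d) = tag (val c) -> map f (entries c) = map Some (entries d) ->
  sat_constr c f.
Proof.
case: c d => [[R t] Rt] [[R' a] Ra] /= E; case: _ / E in t Rt * => eq_ta.
by apply/exists_inP; exists a => //; apply/eqP/val_inj.
Qed.

(** * From fractional homomorphisms of starred structures to local distributions *)

Section FracStar.
Variables (s : sig) (k : nat) (X A : structure s).
Variables (p : star_univ k X -> star_univ k A -> rat).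
Variables (q : constr (star k X) -> constr (star k A) -> rat).
Hypothesis pq : @frac_hom _ (star k X) (star k A) p q.

Lemma entries_mem (t : sig) (Y : structure t) (d : constr Y) (R : sym t) (y : (ar R).-tuple (univ Y)) :
  tag (val d) = R -> entries d = y -> y \in srel Y R.
Proof.
case: d => -[R' u] Ru /= E; rewrite /entries /=.
by case: _ / E in y * => /val_inj <-.
Qed.

(** For each unary relation holding at [u], the marginal condition at this constraint gives a
    constraint in the support of [q] whose only entry is [b]. *)
Lemma frac_support u b : p u b != 0 ->
  kind b = kind u /\
  forall i i' x, onth (elts u) i = Some x -> onth (elts u) i' = Some x ->
    onth (elts b) i = onth (elts b) i'.
Proof.
move=> pub; apply: unary_transfer => r ru.
have ru' : [tuple u] \in srel (star k X) (inl r) by rewrite inE.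
pose c : constr (star k X) :=
  exist (fun d : {R : sym (sigstar s k) & (ar R).-tuple (star_univ k X)} =>
           tagged d \in srel (star k X) (tag d))
    (Tagged (fun R : sym (sigstar s k) => (ar R).-tuple (star_univ k X))
       ([tuple u] : (@ar (sigstar s k) (inl r)).-tuple _)) ru'.
have := @frac_marg _ _ _ _ _ pq c 0 u b erefl.
case: (pickP (fun d : constr (star k A) =>
  (onth (entries d) 0 == Some (b : univ (star k A))) && (q c d != 0))); last first.
  move=> H; rewrite big1 => [E|d db]; first by rewrite E eqxx in pub.
  by have := H d; rewrite db => /negbFE /eqP.
move=> d /andP [/eqP db /(frac_supp pq) td] _.
have ed : entries d = [tuple b].
  have : size (entries d) = 1 by rewrite size_entries td.
  by case: (entries d) db => [|b' []] //= [->].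
by have := @entries_mem _ _ d (inl r) [tuple b] td ed; rewrite inE.
Qed.

(** The mass that [q] gives to the images of the constraint on [u] and [w], collected by their two
    entries, is a coupling; its marginals are those at positions 0 and 1. *)
Lemma frac_coupling r u w : binary_holds r u w ->
  exists Q : star_univ k A -> star_univ k A -> rat,
    [/\ forall b b', Q b b' != 0 -> p u b != 0 /\ binary_holds r b b',
        forall b, p u b = \sum_b' Q b b' &
        forall b', p w b' = \sum_b Q b b'].
Proof.
move=> ruw.
have ruw' : [tuple u; w] \in srel (star k X) (inr r) by rewrite inE.
pose c : constr (star k X) :=
  exist (fun d : {R : sym (sigstar s k) & (ar R).-tuple (star_univ k X)} =>
           tagged d \in srel (star k X) (tag d))
    (Tagged (fun R : sym (sigstar s k) => (ar R).-tuple (star_univ k X))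
       ([tuple u; w] : (@ar (sigstar s k) (inr r)).-tuple _)) ruw'.
have entries_d d : q c d != 0 ->
    exists bb, entries d = [:: bb.1; bb.2] /\ binary_holds r bb.1 bb.2.
  move=> /(frac_supp pq) td.
  have : size (entries d) = 2 by rewrite size_entries td.
  case ed : (entries d) => [|b [|b' []]] // _; exists (b, b'); split=> //.
  by have := @entries_mem _ _ d (inr r) [tuple b; b'] td ed; rewrite inE.
pose Q b b' := \sum_(d : constr (star k A) | entries d == [:: b; b']) q c d.
have Q_ge0 b b' : 0 <= Q b b' by apply: sumr_ge0 => d _; apply: frac_mass_ge0 pq _ _.
have pu b : p u b = \sum_b' Q b b'.
  rewrite (@frac_marg _ _ _ _ _ pq c 0 u b erefl) /Q (exchange_big_dep xpredT) //=.
  rewrite big_mkcond; apply: eq_bigr => d _.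
  have [-> | /entries_d [[b1 b2] /= [ed _]]] := eqVneq (q c d) 0.
    by rewrite if_same big1.
  rewrite ed /= (inj_eq (@Some_inj _)); case: eqP => [->|ne]; last first.
    by rewrite big1 // => b' /eqP [/ne].
  by rewrite (big_pred1 b2) // => b' /=; rewrite !eqseq_cons eqxx andbT eq_sym.
have pw b' : p w b' = \sum_b Q b b'.
  rewrite (@frac_marg _ _ _ _ _ pq c 1 w b' erefl) /Q (exchange_big_dep xpredT) //=.
  rewrite big_mkcond; apply: eq_bigr => d _.
  have [-> | /entries_d [[b1 b2] /= [ed _]]] := eqVneq (q c d) 0.
    by rewrite if_same big1.
  rewrite ed /= (inj_eq (@Some_inj _)); case: eqP => [->|ne]; last first.
    by rewrite big1 // => b /eqP [_ /ne].
  by rewrite (big_pred1 b1) // => b /=; rewrite !eqseq_cons eqxx !andbT eq_sym.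
exists Q; split=> // b b' Qbb'; split.
  apply: contra_neq Qbb' => pub0; apply/eqP.
  move: pub0; rewrite pu => /eqP; rewrite psumr_eq0 // => /allP /(_ b').
  by rewrite mem_index_enum => /(_ isT).
case: (pickP (fun d : constr (star k A) => (entries d == [:: b; b']) && (q c d != 0))).
  by move=> d /andP [/eqP ed /entries_d [[b1 b2]]]; rewrite ed => -[[<- <-]].
move=> H; move: Qbb'; rewrite /Q big1 ?eqxx // => d ed.
by have := H d; rewrite ed => /negbFE /eqP.
Qed.

(** Positionwise partial map from the entries of [u] to those of [b]. On the support of [p u],
    [frac_support] makes the use of first occurrences harmless, and off the entries of [u] the index
    overflows to [None]. *)
Definition transport (u : star_univ k X) (b : star_univ k A) : {ffun univ X -> option (univ A)} :=
  [ffun x => onth (elts b) (index x (elts u))].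

Definition local_prob u (f : {ffun univ X -> option (univ A)}) : rat :=
  \sum_(b | transport u b == f) p u b.

Lemma transport_dom u b : p u b != 0 ->
  pdom (transport u b) = [set x in elts u].
Proof.
move=> /frac_support [kb _]; apply/setP => x.
have -> : (x \in pdom (transport u b)) = onth (elts b) (index x (elts u)).
  by rewrite inE ffunE; case: onth.
by rewrite onthTE (size_elts kb) index_mem inE.
Qed.

Lemma local_prob_ge0 u f : 0 <= local_prob u f.
Proof. by apply: sumr_ge0 => b _; apply: frac_ge0 pq _ _. Qed.

Lemma local_prob_le1 u f : local_prob u f <= 1.
Proof.
rewrite -(frac_sum pq u) /local_prob big_mkcond; apply: ler_sum => b _.
by case: ifP => // _; apply: frac_ge0 pq _ _.
Qed.

Lemma local_prob_push u (P : pred {ffun univ X -> option (univ A)}) :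
  \sum_(f | (pdom f == [set x in elts u]) && P f) local_prob u f =
  \sum_(b | P (transport u b)) p u b.
Proof.
rewrite /local_prob (exchange_big_dep xpredT) //= [RHS]big_mkcond.
apply: eq_bigr => b _; have [->|pub] := eqVneq (p u b) 0.
  by rewrite big1 ?if_same.
case: ifP => Pb; last first.
  by rewrite big1 // => f /andP [/andP [_ Pf] /eqP E]; rewrite -E Pb in Pf.
rewrite (big_pred1 (transport u b)) // => f /=.
rewrite [transport u b == f]eq_sym; case: (f =P _) => [->|]; rewrite ?andbF //.
by rewrite Pb (transport_dom pub) eqxx.
Qed.

Lemma local_prob_sum u :
  \sum_(f | pdom f == [set x in elts u]) local_prob u f = 1.
Proof.
rewrite -(frac_sum pq u) -(local_prob_push u xpredT).
by apply: eq_bigl => f; rewrite andbT.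
Qed.

(** Couple [u] and [w] along the projection relation: for pairs of nonzero weight, the partial map
    of [w] is the restriction of that of [u]. *)
Lemma local_prob_marg u w j f : kind w = inl j -> {subset elts w <= elts u} ->
  local_prob w f = \sum_(g | (pdom g == [set x in elts u]) &&
     (prestr [set x in elts w] g == f)) local_prob u g.
Proof.
move=> kw sub_wu; have [r rP] := binary_proj kw sub_wu.
have [|Q [Qsupp pu pw]] := @frac_coupling r u w.
  by apply/rP; split=> //; apply/eq_in_map => x /sub_wu /onth_index ->.
rewrite (local_prob_push u (fun g => prestr [set x in elts w] g == f)).
rewrite /local_prob; under eq_bigr do rewrite pw.
under [RHS]eq_bigr do rewrite pu.
rewrite big_mkcond [RHS]big_mkcond /=.
transitivity (\sum_b' \sum_b if transport w b' == f then Q b b' else 0).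
  by apply: eq_bigr => b' _; case: ifP => // _; rewrite big1.
rewrite exchange_big; apply: eq_bigr => b _.
transitivity (\sum_b' if prestr [set x in elts w] (transport u b) == f then Q b b' else 0).
  apply: eq_bigr => b' _; have [->|/Qsupp [_ /rP [_ _ eb']]] := eqVneq (Q b b') 0.
    by rewrite !if_same.
  suff -> : transport w b' = prestr [set x in elts w] (transport u b) by [].
  apply/ffunP => x; rewrite !ffunE inE.
  have := congr1 (fun r => nth None r (index x (elts w))) eb'; rewrite -onthE => ->.
  case: ifP => xw; last by rewrite nth_default // size_map leqNgt index_mem xw.
  by rewrite (nth_map x) ?index_mem // nth_index.
by case: ifP => // _; rewrite big1.
Qed.

(** A nonzero probability comes from some [b] in the support of [p (inr c)], which is a constraint
    of [A] with the symbol of [c]; its tuple is the image under [f]. *)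
Lemma local_prob_sat (c : constr X) f :
  ~~ @sat_constr s X A c f -> local_prob (inr c) f = 0.
Proof.
apply: contraNeq => P0.
case: (pickP (fun b => (transport (inr c) b == f) && (p (inr c) b != 0))); last first.
  move=> H; case/eqP: P0; apply: big1 => b bf.
  by have := H b; rewrite bf => /negbFE /eqP.
move=> b /andP [/eqP <- /frac_support [kb eqb]]; move: kb eqb.
case: b => [?|d] // [td] eqb; apply: (sat_constr_entries td).
have /= sz : size (elts (inr d : star_univ k A)) = size (elts (inr c : star_univ k X)).
  by apply: size_elts; rewrite /= td.
apply/(eq_onthP 0%N 2%N) => i; rewrite !onth_map.
have [|le] := ltnP i (size (entries c)); last by rewrite !onth_default ?sz.
rewrite -onthTE; case ci : (onth (entries c) i) => [x|] // _ /=.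
rewrite ffunE -(eqb i _ x) //=; last first.
  by apply: onth_index; apply/onthP; exists i.
have : onth (entries d) i by rewrite onthTE sz -onthTE ci.
by case: (onth (entries d) i).
Qed.

End FracStar.

Lemma frac_SA (s : sig) (X A : structure s) (k : nat) :
  (forall R : sym s, (0 < ar R)%N) ->
  frac_homto (star k.+1 X) (star k.+1 A) -> SA_feasible X A k.+1.
Proof.
move=> ar_pos [p [q pq]].
(* Over an empty universe there are neither nonempty sets nor, arities being positive,
   constraints. *)
case: (pickP (univ X)) => [x0 _|X0]; last first.
  have noV (V : {set univ X}) : V = set0 by apply/setP => x; have := X0 x.
  have noC (c : constr X) : False.
    by have := X0 (tnth (tagged (val c)) (Ordinal (ar_pos (tag (val c))))).
  exists (fun _ _ => 0), (fun _ _ => 0); split; last split; last split; last split; last split.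
  - by move=> V f; rewrite (noV V) cards0.
  - by move=> c; case: (noC c).
  - by move=> V; rewrite (noV V) cards0.
  - by move=> U V f; rewrite (noV U) eqxx.
  - by move=> c; case: (noC c).
  by move=> c; case: (noC c).
(* Enumerate [V] and pad with its first element, so that all sets are represented by tuples of the
   maximal length [k.+1]. *)
pose v (V : {set univ X}) : k.+1.-tuple (univ X) :=
  [tuple nth (head x0 (enum V)) (enum V) i | i < k.+1].
have vE (V : {set univ X}) : (1 <= #|V| <= k.+1)%N -> v V =i V.
  rewrite cardE => /andP [V_gt0 V_le] x; rewrite -mem_enum; apply/mapP/idP.
    case=> i _ ->; case: (enum V) V_gt0 => //= y r _.
    have [lt|le] := ltnP i (size (y :: r)); first exact: mem_nth.
    by rewrite nth_default // mem_head.
  move=> xV; have lt : (index x (enum V) < k.+1)%N.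
    by apply: leq_trans V_le; rewrite index_mem.
  by exists (Ordinal lt); rewrite ?mem_enum //= nth_index.
pose T V : star_univ k.+1 X :=
  inl (Tagged (fun j : 'I_k.+1 => j.+1.-tuple (univ X)) (v V : ((ord_max : 'I_k.+1).+1).-tuple _)).
have dom_T (V : {set univ X}) : (1 <= #|V| <= k.+1)%N -> [set x in elts (T V)] = V.
  by move=> hV; apply/setP => x; rewrite inE; apply: vE.
exists (fun V => local_prob p (T V)), (fun c => local_prob p (inr c)).
split; last split; last split; last split; last split.
- by move=> V f _ _; rewrite (local_prob_ge0 pq) (local_prob_le1 pq).
- by move=> c f _; rewrite (local_prob_ge0 pq) (local_prob_le1 pq).
- move=> V hV; rewrite -[RHS](local_prob_sum pq (T V)); by rewrite dom_T.
- move=> U V f U0 UV Vk Uf.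
  have hU : (1 <= #|U| <= k.+1)%N.
    by rewrite card_gt0 U0 (leq_trans (subset_leq_card UV)).
  have hV : (1 <= #|V| <= k.+1)%N.
    by rewrite Vk andbT card_gt0; apply: contraNneq U0 => V0; rewrite V0 subset0 in UV.
  rewrite (local_prob_marg pq (u := T V) (j := ord_max)) ?dom_T // => x.
  by rewrite vE // vE // => /(subsetP UV).
- move=> c U f U0 Uc Uk Uf.
  have hU : (1 <= #|U| <= k.+1)%N by rewrite card_gt0 U0.
  rewrite (local_prob_marg pq (u := inr c) (j := ord_max)) ?dom_T // => x.
  by rewrite vE // => /(subsetP Uc); rewrite inE.
by move=> c f _ /(local_prob_sat pq).
Qed.

(** * Extending maps to starred structures *)

Section Extension.
Variables (s : sig) (k : nat) (X A : structure s) (b0 : star_univ k A).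
Implicit Type h : univ X -> univ A.

(** The default [b0] keeps the map total, as a locally sampled [h] may violate constraints of [X];
    [respects] rules this out at a given vertex. *)
Definition star_map h (w : star_univ k X) : star_univ k A :=
  match w with
  | inl t => inl (Tagged (fun j : 'I_k => j.+1.-tuple (univ A)) (map_tuple h (tagged t)))
  | inr c => if insub (Tagged (fun R => (ar R).-tuple (univ A)) (map_tuple h (tagged (val c))))
               is Some d then inr d else b0
  end.

Lemma eq_star_map h h' (w : star_univ k X) :
  {in elts w, h =1 h'} -> star_map h w = star_map h' w.
Proof.
have mapE n (t : n.-tuple (univ X)) : {in tval t, h =1 h'} -> map_tuple h t = map_tuple h' t.
  by move=> hh; apply: val_inj; apply/eq_in_map.
case: w => [[j t]|c] hh /=; first by rewrite (mapE _ t hh).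
by rewrite (mapE _ _ hh).
Qed.

Definition respects h (u : star_univ k X) : Prop :=
  if u is inr c then map_tuple h (tagged (val c)) \in srel A (tag (val c)) else True.

Lemma allEq_map h n (t : n.-tuple (univ X)) (S : {set 'I_n}) :
  allEq t S -> allEq (map_tuple h t) S.
Proof.
move=> /forall_inP tS; apply/forall_inP => i iS; apply/forall_inP => i' iS'.
by have /forall_inP/(_ i' iS') /eqP E := tS i iS; rewrite !tnth_map E.
Qed.

Lemma star_map_isC h (u : star_univ k X) (R : sym s) (t : (ar R).-tuple (univ X)) :
  respects h u -> isC u (Tagged (fun R => (ar R).-tuple (univ X)) t) ->
  map_tuple h t \in srel A R /\
  isC (star_map h u) (Tagged (fun R => (ar R).-tuple (univ A)) (map_tuple h t)).
Proof.
case: u => // c; rewrite /respects /isC => hc /eqP E.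
move: hc; rewrite /= E /= => hc; split=> //.
by rewrite insubT /= eqxx.
Qed.

Lemma star_map_unary h r (u : star_univ k X) :
  respects h u -> unary_holds r u -> unary_holds r (star_map h u).
Proof.
case: r => [[j S]|[R S]] hu.
  case/existsP => t /andP [/eqP -> tS]; apply/existsP; exists (map_tuple h t).
  by rewrite eqxx allEq_map.
case/existsP => t /and3P [_ ut tS]; apply/existsP; exists (map_tuple h t).
by have [-> ->] := star_map_isC hu ut; rewrite allEq_map.
Qed.

Lemma map_proj h n m (i : m.-tuple 'I_n) (a : n.-tuple (univ X)) :
  map_tuple h (proj i a) = proj i (map_tuple h a).
Proof. by apply: eq_from_tnth => l; rewrite !tnth_map. Qed.

(** The condition is placed on [u] because [w] is always a tuple. *)
Lemma star_map_binary h r (u w : star_univ k X) :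
  respects h u -> binary_holds r u w -> binary_holds r (star_map h u) (star_map h w).
Proof.
case: r => [[j [j' i]]|[R [j i]]] hu.
  case/existsP => t /andP [/eqP -> /eqP ->]; apply/existsP; exists (map_tuple h t).
  by rewrite eqxx /= map_proj.
case/existsP => t /and3P [_ ut /eqP ->]; apply/existsP; exists (map_tuple h t).
by have [-> ->] := star_map_isC hu ut; rewrite /= map_proj eqxx.
Qed.

Lemma binary_sub r (u w : star_univ k X) : binary_holds r u w ->
  (exists j, kind w = inl j) /\ {subset elts w <= elts u}.
Proof.
have sub n m (i : m.-tuple 'I_n) (t : n.-tuple (univ X)) :
  {subset tval (proj i t) <= tval t}.
  by move=> x /tnthP [l ->]; rewrite tnth_map mem_tnth.
case: r => [[j [j' i]]|[R [j i]]].
  by case/existsP => t /andP [/eqP -> /eqP ->]; split; [exists j' | apply: sub].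
case/existsP => t /and3P [_ ut /eqP ->]; split; first by exists j.
case: u ut => // c /eqP ct; have -> : elts (inr c : star_univ k X) = t.
  exact: (congr1 (fun x => tval (tagged x)) ct).
exact: sub.
Qed.

End Extension.

(** * Sampling a Sherali-Adams solution *)

Section LocalDistributions.
Variables (s : sig) (k : nat) (X A : structure s).
Variable Q : star_univ k X -> {ffun univ X -> option (univ A)} -> rat.
Let dom (u : star_univ k X) : {set univ X} := [set x in elts u].
Hypothesis Q_ge0 : forall u f, pdom f = dom u -> 0 <= Q u f.
Hypothesis Q_sum : forall u, \sum_(f | pdom f == dom u) Q u f = 1.
Hypothesis Q_marg : forall u w f j,
  kind w = inl j -> {subset elts w <= elts u} -> pdom f = dom w ->
  Q w f = \sum_(g | (pdom g == dom u) && (prestr (dom w) g == f)) Q u g.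
Hypothesis Q_sat : forall c f,
  pdom f = scope c -> ~~ @sat_constr s X A c f -> Q (inr c) f = 0.

(** One denominator [m] serves all vertices; the integers obtained from [m%:R * Q u f] sum to [m]
    for each [u] and become fibre sizes. *)
Lemma integral_sampling : exists2 m : nat, (0 < m)%N &
  exists F : star_univ k X -> 'I_m -> {ffun univ X -> option (univ A)},
    forall u f, #|[set l | F u l == f]|%:R =
      if pdom f == dom u then m%:R * Q u f else 0.
Proof.
have [m m_gt0 mP] := common_denominator (fun uf => Q uf.1 uf.2).
exists m => //.
have counts u f : exists n : nat,
    n%:R = if pdom f == dom u then m%:R * Q u f else 0.
  case: (pdom f =P _) => [/Q_ge0 Qge0|_]; last by exists 0%N.
  by have [n nE] := mP (u, f) Qge0; exists n.
have [n nP] := fin_all_exists (fun u => fin_all_exists (counts u)).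
have n_sum u : (\sum_f n u f)%N = m.
  apply/eqP; rewrite -(eqr_nat rat) natr_sum; apply/eqP.
  under eq_bigr do rewrite nP.
  by rewrite -big_mkcond -mulr_sumr Q_sum mulr1.
have ex_F u : exists F : 'I_m -> {ffun univ X -> option (univ A)},
    forall f, #|[set l | F l == f]| = n u f.
  by rewrite -(n_sum u); apply: labelling_with_fibers.
have [F FP] := fin_all_exists ex_F.
by exists F => u f; rewrite FP nP.
Qed.

Variables (m : nat) (F : star_univ k X -> 'I_m -> {ffun univ X -> option (univ A)}).
Hypothesis F_fiber : forall u f, #|[set l | F u l == f]|%:R =
  if pdom f == dom u then m%:R * Q u f else 0.

Lemma sample_supp u l : pdom (F u l) = dom u /\ Q u (F u l) != 0.
Proof.
have : (#|[set l' | F u l' == F u l]|%:R : rat) != 0.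
  by rewrite pnatr_eq0 -lt0n; apply/card_gt0P; exists l; rewrite inE.
rewrite F_fiber; case: (pdom _ =P _) => [dF|_]; last by rewrite eqxx.
by rewrite mulf_eq0 negb_or => /andP [].
Qed.

(** Marginalization in counting form; if the domain of [f] is not that of [w], both fibres are
    empty. *)
Lemma sample_restr u w f j : kind w = inl j -> {subset elts w <= elts u} ->
  #|[set l | prestr (dom w) (F u l) == f]| = #|[set l | F w l == f]|.
Proof.
move=> kw sub_wu; have [df|ne_df] := eqVneq (pdom f) (dom w); last first.
  rewrite !eq_card0 // => l; rewrite inE; apply/negP => /eqP lf.
    by have [dF _] := sample_supp w l; rewrite -lf dF eqxx in ne_df.
  case/eqP: ne_df; apply/setP => x; rewrite -lf !inE ffunE inE.
  case: ifP => // xw; have [/setP/(_ x)] := sample_supp u l.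
  by rewrite !inE sub_wu.
apply/eqP; rewrite -(eqr_nat rat) F_fiber df eqxx (Q_marg kw sub_wu df).
rewrite card_fiber_comp natr_sum.
under eq_bigr do rewrite F_fiber.
rewrite -big_mkcondr mulr_sumr; apply/eqP; apply: eq_bigl => g; exact: andbC.
Qed.

Variable a0 : univ A.
Definition total_map (f : {ffun univ X -> option (univ A)}) (x : univ X) : univ A :=
  odflt a0 (f x).

Lemma sample_respects u l : respects (total_map (F u l)) u.
Proof.
case: u => // c; have [dF QF] := sample_supp (inr c) l.
have : sat_constr c (F (inr c) l).
  by apply: contraNT QF => nsat; rewrite Q_sat.
case/exists_inP => a Ra /eqP E.
rewrite /respects (_ : map_tuple _ _ = a) //; apply: eq_from_tnth => i.
have := congr1 (fun t => tnth t i) E; rewrite !tnth_map /total_map => /(congr1 (odflt a0)).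
by [].
Qed.

(** A whole constraint is sampled at its first vertex, of which the second one, if any, is a
    projection. *)
Definition head_elt (r : sym (sigstar s k)) :
    (ar r).-tuple (star_univ k X) -> star_univ k X :=
  match r as r0 return (@ar (sigstar s k) r0).-tuple (star_univ k X) -> star_univ k X with
  | inl _ => fun t : 1.-tuple _ => tnth t ord0
  | inr _ => fun t : 2.-tuple _ => tnth t ord0
  end.

Variable b0 : star_univ k A.

Lemma sample_head (r : sym (sigstar s k)) (t : (ar r).-tuple (star_univ k X)) l :
  t \in srel (star k X) r ->
  map_tuple (star_map b0 (total_map (F (head_elt t) l))) t \in srel (star k A) r.
Proof.
case: r t => r t; rewrite !inE !tnth_map.
  exact: star_map_unary (sample_respects _ _).
exact: star_map_binary (sample_respects _ _).
Qed.

(** At the second position only the restriction of the sample to the entries of [w] matters, and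
    [sample_restr] equates its fibres with those sampled at [w]. *)
Lemma sample_marginal (r : sym (sigstar s k)) (t : (ar r).-tuple (star_univ k X)) w a :
  t \in srel (star k X) r -> w \in tval t ->
  #|[set l | star_map b0 (total_map (F (head_elt t) l)) w == a]| =
  #|[set l | star_map b0 (total_map (F w l)) w == a]|.
Proof.
case: r t => r t; rewrite inE /head_elt => rt /tnthP [i ->].
  by rewrite (ord1 i).
have [->|] := eqVneq i ord0; first by [].
have [[j kw] sub_wu] := binary_sub rt.
move=> i_ne0; have -> : i = ord_max.
  by apply: val_inj; case: i i_ne0 => [[|[]]].
set u := tnth t ord0 in sub_wu *; set w' := tnth t ord_max in kw sub_wu *.
have eq_map f : star_map b0 (total_map f) w' = star_map b0 (total_map (prestr (dom w') f)) w'.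
  by apply: eq_star_map => x xw; rewrite /total_map ffunE inE xw.
transitivity #|[set l | star_map b0 (total_map (prestr (dom w') (F u l))) w' == a]|.
  by apply: eq_card => l; rewrite !inE eq_map.
rewrite (card_fiber_comp (fun l => prestr (dom w') (F u l)) (fun f => star_map b0 (total_map f) w')).
rewrite (card_fiber_comp (F w') (fun f => star_map b0 (total_map f) w')).
by apply: eq_bigr => f _; apply: sample_restr kw sub_wu.
Qed.

End LocalDistributions.

Lemma SA_cover (s : sig) (X A : structure s) (k : nat) :
  (forall R : sym s, (0 < ar R)%N) -> (0 < k)%N -> SA_feasible X A k ->
  exists Y1 Y2 : structure (sigstar s k),
    homto (star k X) Y1 /\ equiv1 Y1 Y2 /\ homto Y2 (star k A).
Proof.
move=> ar_pos k_gt0 [pV [pC [pV_ge0 [pC_ge0 [pV_sum [pV_marg [pC_marg pC_sat]]]]]]].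
case: (pickP (univ X)) => [x0 _|X0]; last first.
  have noU (u : star_univ k X) : False.
    case: u => [[j t]|c]; first by have := X0 (tnth t ord0).
    by have := X0 (tnth (tagged (val c)) (Ordinal (ar_pos (tag (val c))))).
  exists (star k X), (star k X); split; last split.
  - exact: homto_refl.
  - by exists id; split=> //; exists id.
  exists (fun u => False_rect _ (noU u)) => r t.
  by case: r t => r t; case: (noU (tnth t ord0)).
pose dom (u : star_univ k X) : {set univ X} := [set x in elts u].
(* Both families of variables become one, indexed by the elements of the starred structure; a tuple
   gets the distribution of its set of entries. *)
pose Q (u : star_univ k X) :=
  match u with inl t => pV [set x in tval (tagged t)] | inr c => pC c end.
have dom_tuple w j : kind w = inl j -> (1 <= #|dom w| <= k)%N.
  case: w => // -[j' t] _; apply/andP; split.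
    by apply/card_gt0P; exists (tnth t ord0); rewrite inE mem_tnth.
  apply: leq_trans (ltn_ord j'); rewrite cardsE; apply: leq_trans (card_size _) _.
  by rewrite size_tuple.
have Q_ge0 u f : pdom f = dom u -> 0 <= Q u f.
  case: u => [[j t]|c] /= df; last by case/andP: (pC_ge0 _ _ df).
  have := @dom_tuple (inl (existT _ j t)) j erefl.
  by move=> hV; case/andP: (pV_ge0 _ f hV df).
have Q_marg u w f j : kind w = inl j -> {subset elts w <= elts u} -> pdom f = dom w ->
    Q w f = \sum_(g | (pdom g == dom u) && (prestr (dom w) g == f)) Q u g.
  move=> kw sub_wu df; have /andP [w_gt0 w_le] := dom_tuple w j kw.
  have sub_dom : dom w \subset dom u.
    by apply/subsetP => x; rewrite !inE; apply: sub_wu.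
  have w_ne0 : dom w != set0 by rewrite -card_gt0.
  case: w kw sub_wu df w_gt0 w_le sub_dom w_ne0 => // -[j' t] _ _ df w_gt0 w_le sub_dom w_ne0.
  case: u sub_dom => [[ju tu]|c] sub_dom; last exact: pC_marg.
  apply: pV_marg => //.
  by case/andP: (@dom_tuple (inl (existT _ ju tu)) ju erefl).
(* The relaxation states total mass 1 for [pV]; for a constraint it follows by marginalizing [pC c]
   to a single entry. *)
have Q_sum u : \sum_(f | pdom f == dom u) Q u f = 1.
  case: u => [[j t]|c].
    exact: (pV_sum _ (@dom_tuple (inl (existT _ j t)) j erefl)).
  pose x := tnth (tagged (val c)) (Ordinal (ar_pos (tag (val c)))).
  have xc : [set x] \subset scope c by rewrite sub1set inE mem_tnth.
  have x_ne0 : [set x] != set0 by rewrite -card_gt0 cards1.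
  have x_le : (#|[set x]| <= k)%N by rewrite cards1.
  rewrite -(pV_sum [set x]) ?cards1 //.
  rewrite (partition_big (prestr [set x]) (fun h => pdom h == [set x])) /=.
    by apply: eq_bigr => h /eqP dh; rewrite (pC_marg c).
  move=> f /eqP df; apply/eqP/setP => y; rewrite !inE ffunE inE.
  case: (y =P x) => // ->; have : x \in pdom f by rewrite df inE mem_tnth.
  by rewrite inE.
have [m m_gt0 [F FP]] := integral_sampling Q_ge0 Q_sum.
(* A sample at a constant tuple is defined at [x0], so [A] has an element. *)
have a0 : univ A.
  pose u : star_univ k X := inl (Tagged (fun j : 'I_k => j.+1.-tuple (univ X))
    (nseq_tuple (Ordinal k_gt0).+1 x0)).
  have [dF _] := sample_supp FP u (Ordinal m_gt0).
  have : x0 \in pdom (F u (Ordinal m_gt0)) by rewrite dF inE mem_head.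
  by rewrite inE; case: (F u _ x0).
pose b0 : star_univ k A := inl (Tagged (fun j : 'I_k => j.+1.-tuple (univ A))
  (nseq_tuple (Ordinal k_gt0).+1 a0)).
apply: (@labelling_cover _ _ (star k X) (star k A) m
  (fun w l => star_map b0 (total_map a0 (F w l)) w)
  (fun c l => star_map b0 (total_map a0 (F (head_elt (tagged c)) l)))) => //.
- by case.
- by move=> r t l; apply: (sample_head pC_sat FP).
by move=> r t w a; apply: (sample_marginal Q_marg FP).
Qed.

Local Close Scope ring_scope.

Theorem theorem7p4 (s : sig) (ar_pos : forall R : sym s, (0 < ar R)%N)
  (X A : structure s) (k : nat) (hk : (1 <= k)%N) :
  (SA_feasible X A k <->
     exists (n : nat) (Y : nat -> structure (sigstar s k)),
       Y 0%N = star k X /\ Y n = star k A /\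
       forall i : nat, (i < n)%N ->
         homto (Y i) (Y i.+1) \/ equiv1 (Y i) (Y i.+1)) /\
  (SA_feasible X A k <->
     exists Y1 Y2 : structure (sigstar s k),
       homto (star k X) Y1 /\ equiv1 Y1 Y2 /\ homto Y2 (star k A)).
Proof.
have ar_star (r : sym (sigstar s k)) : (0 < ar r)%N by case: r.
have SA_imp := @SA_cover s X A k ar_pos hk.
have cover_chain : (exists Y1 Y2 : structure (sigstar s k),
    homto (star k X) Y1 /\ equiv1 Y1 Y2 /\ homto Y2 (star k A)) ->
  exists (n : nat) (Y : nat -> structure (sigstar s k)),
       Y 0%N = star k X /\ Y n = star k A /\
       forall i : nat, (i < n)%N ->
         homto (Y i) (Y i.+1) \/ equiv1 (Y i) (Y i.+1).
  move=> [Y1 [Y2 [XY1 [Y12 Y2A]]]].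
  (* The last structure of the chain is the default value of [nth]. *)
  exists 3, (nth (star k A) [:: star k X; Y1; Y2]); split=> //; split=> //.
  by move=> [|[|[|i]]] //= _; [left | right | left].
have chain_SA : (exists (n : nat) (Y : nat -> structure (sigstar s k)),
       Y 0%N = star k X /\ Y n = star k A /\
       forall i : nat, (i < n)%N ->
         homto (Y i) (Y i.+1) \/ equiv1 (Y i) (Y i.+1)) -> SA_feasible X A k.
  move=> [n [Y [Y0 [Yn step]]]].
  (* Both kinds of step are fractional homomorphisms, and these compose along the chain. *)
  have frac_prefix i : (i <= n)%N -> frac_homto (Y 0%N) (Y i).
    elim: i => [|i IH] le_in; first exact: homto_frac (homto_refl _).
    apply: frac_homto_trans (IH (ltnW le_in)) _.
    by case: (step i le_in) => [/homto_frac|/(equiv1_frac ar_star)].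
  have := frac_prefix n (leqnn n); rewrite Y0 Yn.
  by case: k hk {SA_imp cover_chain ar_star Y Y0 Yn step frac_prefix} => // k _; apply: frac_SA.
by split; split; [move=> /SA_imp /cover_chain | | | move=> /cover_chain].
Qed.
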